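(* Suppose the potential outcomes satisfy the network latent factor model described in the context. If the training treatments $A^{\mathrm{tr}}$ are assigned by the graph-coloring experiment design with parameter $\bar r$ described in the context, then TrainingTreatmentTest with hyperparameter $\bar r$ is passed for every unit $n\in[N]$ and every counterfactual treatment $\tilde a_{\mathcal N(n)}\in[D]^{|\mathcal N(n)|}$.
   Context: $[X]=\{1,\dots,X\}$. There are $N$ units and $D\ge2$ treatments. $\mathcal G=([N],\mathcal E)$ is a fixed, known undirected graph with all self-edges; $\mathcal N(n)=\{j:(j,n)\in\mathcal E\}\ni n$. $M[S_1,S_2]$ is a submatrix. Network latent factor model: for all measurements $t$, units $n$, and $a\in[D]^N$, the potential outcome is $Y^{(a)}_{t,n}=\sum_{j\in\mathcal N(n)}\langle u_{j,n},w_{t,a_j}\rangle+\epsilon^{(a_{\mathcal N(n)})}_{t,n}$ with latent $u_{j,n},w_{t,b}\in\mathbb R^r$ and noise of zero mean conditional on the latent factors. Experiment design (parameter $\bar r\in\mathbb N_{>0}$): Let $\mathcal G'$ be the graph on $[N]$ joining distinct $i,k$ whenever $(i,k)\in\mathcal E$ or $(i,j),(j,k)\in\mathcal E$ for some $j$. Properly color $\mathcal G'$ greedily (adding a new color only when no existing color can be used), giving NumColors colors and $\mathrm{Coloring}\in[\mathrm{NumColors}]^N$. Let $T'=\lceil \mathrm{NumColors}/(D-1)\rceil$ and partition the colors into consecutive sets $\mathrm{Colors}_0,\dots,\mathrm{Colors}_{T'-1}$, the first $D-1$ colors in $\mathrm{Colors}_0$, the next $D-1$ in $\mathrm{Colors}_1$,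 and so on. For $\ell=0,\dots,T'-1$ let $c^\ell\in[D]^N$ be $c^\ell_i=(\mathrm{Coloring}_i \bmod (D-1))+2$ if $\mathrm{Coloring}_i\in\mathrm{Colors}_\ell$ and $c^\ell_i=1$ otherwise. Partition the training measurements $\mathcal T_{\mathrm{tr}}$ into disjoint sets $\mathcal T^0_{\mathrm{tr}},\dots,\mathcal T^{T'-1}_{\mathrm{tr}}$, each of size $\bar T\ge\bar rD$ (so $T_{\mathrm{tr}}=\bar TT'$), and set $A^{\mathrm{tr}}[:,t]=c^\ell$ for $t\in\mathcal T^\ell_{\mathrm{tr}}$, giving $A^{\mathrm{tr}}\in[D]^{N\times T_{\mathrm{tr}}}$. TrainingTreatmentTest (hyperparameter $\bar r$): for $a\in[D]$ let $B^{\mathrm{tr}}(a)\in\{0,1\}^{N\times T_{\mathrm{tr}}}$ have entries $\mathbf 1(A^{\mathrm{tr}}_{it}=a)$ and, for a target $\tilde a\in[D]^N$, let $\tilde b(a)\in\{0,1\}^N$ have entries $\mathbf 1(\tilde a_i=a)$; $B^{\mathrm{tr}}=[B^{\mathrm{tr}}(1),\dots,B^{\mathrm{tr}}(D)]$, $\tilde B^{\mathrm{pr}}=[\tilde b(1),\dots,\tilde b(D)]$. The test is passed for $n,\tilde a_{\mathcal N(n)}$ if (i) $\mathrm{columnspace}(\tilde B^{\mathrm{pr}}[\mathcal N(n),:])\subseteq\mathrm{columnspace}(B^{\mathrm{tr}}[\mathcal N(n),:])$, and (ii) for every $t\in\mathcal T_{\mathrm{tr}}$ the vector $A^{\mathrm{tr}}[\mathcal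 N(n),t]$ occurs for at least $\bar rD$ of the measurements in $\mathcal T_{\mathrm{tr}}$. *)

(* Defs.v *)
(* MathComp and MathComp-Analysis. *)
From HB Require Import structures.
From mathcomp Require Import all_boot all_order all_algebra.
From mathcomp Require Import all_classical all_reals all_analysis.

Set Implicit Arguments.
Unset Strict Implicit.
Unset Printing Implicit Defensive.

Import Order.TTheory GRing.Theory Num.Theory.
Import numFieldNormedType.Exports.

(* Units, treatments and measurements are the ordinals 'I_N, 'I_D and 'I_T.
   The design below is written with treatment labels 1, ..., D: the label of
   a : 'I_D is a.+1.  Colors are the natural numbers 1, ..., NumColors. *)

Notation assignment N D := {ffun 'I_N -> 'I_D}.

Section Graph.
Variables (N D : nat) (E : rel 'I_N).

Definition nbhd (n : 'I_N) : {set 'I_N} := [set j | E j n]%SET.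

(* [D]^{N(n)}, and the restriction a_{N(n)} of a \in [D]^N. *)
Definition local_assignment (n : 'I_N) :=
  {ffun {j : 'I_N | j \in nbhd n} -> 'I_D}.

Definition restrict (n : 'I_N) (a : assignment N D) : local_assignment n :=
  [ffun j => a (val j)].

(* Hence a statement about a_{N(n)} for all a \in [D]^N covers all of
   [D]^{N(n)}. *)
Lemma restrict_onto (n : 'I_N) (x : local_assignment n) :
  0 < D -> exists a : assignment N D, restrict n a = x.
Proof.
move=> D0; exists [ffun i => if insub i is Some j then x j else Ordinal D0].
by apply/ffunP => j; rewrite !ffunE valK.
Qed.

(* M[N(n), :] *)
Definition nbhd_rows (A : Type) (m : nat) (n : 'I_N) (M : 'M[A]_(N, m)) :
    'M[A]_(#|nbhd n|, m) :=
  rowsub (fun k : 'I_#|nbhd n| => enum_val k) M.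

(* The edges of G'. *)
Definition conflict : rel 'I_N :=
  fun i k => (i != k) && (E i k || [exists j, E i j && E j k]).

End Graph.

Section LatentFactorModel.
Local Open Scope classical_set_scope.
Local Open Scope ring_scope.
Context (R : realType) (d : measure_display) (Omega : measurableType d).
Variable P : probability Omega R.

(* Z is a version of the conditional expectation of X given the
   sub-sigma-algebra F. *)
Definition is_cond_expectation (F : set (set Omega)) (X Z : Omega -> R) :=
  [/\ P.-integrable setT (EFin \o X),
      P.-integrable setT (EFin \o Z),
      forall B : set R, measurable B -> F (Z @^-1` B) &
      forall A, F A ->
        (\int[P]_(omega in A) (X omega)%:E =
         \int[P]_(omega in A) (Z omega)%:E)%E].

(* A random vector of R^r is given by its r coordinates; u n j is u_{j,n},
   which exists only for j \in N(n). *)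
Definition latent_sigma_algebra (N D T r : nat) (E : rel 'I_N)
    (u : forall n : 'I_N,
       {j : 'I_N | j \in nbhd E n} -> 'I_r -> {RV P >-> R})
    (w : 'I_T -> 'I_D -> 'I_r -> {RV P >-> R}) : set (set Omega) :=
  <<s [set A | exists n j k (B : set R),
         measurable B /\ A = u n j k @^-1` B] `|`
      [set A | exists t b k (B : set R),
         measurable B /\ A = w t b k @^-1` B] >>.

Definition latent_factor_model (N D T r : nat) (E : rel 'I_N)
    (Y : assignment N D -> 'I_T -> 'I_N -> {RV P >-> R}) : Prop :=
  exists (u : forall n : 'I_N,
            {j : 'I_N | j \in nbhd E n} -> 'I_r -> {RV P >-> R})
         (w : 'I_T -> 'I_D -> 'I_r -> {RV P >-> R})
         (eps : 'I_T -> forall n : 'I_N,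
            local_assignment D E n -> {RV P >-> R}),
    (forall a t n omega,
       Y a t n omega =
       \sum_(j : {j : 'I_N | j \in nbhd E n})
         \sum_(k < r) u n j k omega * w t (a (val j)) k omega
       + eps t n (restrict E n a) omega) /\
    (forall t n x,
       is_cond_expectation (latent_sigma_algebra u w) (eps t n x) (cst 0)).

End LatentFactorModel.

Section GreedyColoring.
Variables (V : finType) (adj : rel V).

Definition usable (c : {ffun V -> option nat}) (v : V) (k : nat) : bool :=
  [forall x, adj v x ==> (c x != Some k)].

Definition color_vertex (c : {ffun V -> option nat}) (v : V) (k : nat) :
    {ffun V -> option nat} :=
  [ffun x => if x == v then Some k else c x].

(* greedy_run m c: a greedy run can reach the partial coloring c, with colors
   1, ..., m created so far.  The order of the vertices and the choice among
   the usable existing colors are left arbitrary. *)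
Inductive greedy_run : nat -> {ffun V -> option nat} -> Prop :=
| GreedyStart : greedy_run 0 [ffun => None]
| GreedyReuse m c v k : greedy_run m c -> c v = None ->
    0 < k <= m -> usable c v k -> greedy_run m (color_vertex c v k)
| GreedyNew m c v : greedy_run m c -> c v = None ->
    (forall k, 0 < k <= m -> ~~ usable c v k) ->
    greedy_run m.+1 (color_vertex c v m.+1).

Definition greedy_coloring (NumColors : nat) (coloring : V -> nat) : Prop :=
  greedy_run NumColors [ffun v => Some (coloring v)].

End GreedyColoring.

Section Design.
Variables (N D : nat) (E : rel 'I_N).

(* T' is the ceiling of NumColors / (D - 1). *)
Definition num_blocks (NumColors : nat) : nat :=
  (NumColors + (D - 1) - 1) %/ (D - 1).

Definition block_colors (NumColors l : nat) : seq nat :=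
  take (D - 1) (drop (l * (D - 1)) (iota 1 NumColors)).

Definition block_label (NumColors : nat) (coloring : 'I_N -> nat) (l : nat)
    (i : 'I_N) : nat :=
  if coloring i \in block_colors NumColors l then coloring i %% (D - 1) + 2
  else 1.

(* The columns of Atr are indexed by the training measurements: column s is
   measurement enum_val s \in Ttr. *)
Definition coloring_design (T rbar : nat) (Ttr : {set 'I_T})
    (Atr : 'M['I_D]_(N, #|Ttr|)) : Prop :=
  exists (NumColors : nat) (coloring : 'I_N -> nat) (Tbar : nat)
         (part : 'I_(num_blocks NumColors) -> {set 'I_T}),
    greedy_coloring (conflict E) NumColors coloring /\
    [/\ (\bigcup_l part l)%SET = Ttr,
        forall l l', l != l' -> [disjoint part l & part l'],
        forall l, #|part l| = Tbar,
        rbar * D <= Tbar &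
        forall l (s : 'I_#|Ttr|) i, enum_val s \in part l ->
          (Atr i s).+1 = block_label NumColors coloring l i].

End Design.

Section Test.
Local Open Scope ring_scope.
Variables (R : realType) (N D : nat) (E : rel 'I_N).

Definition Btr_block (m : nat) (A : 'M['I_D]_(N, m)) (a : 'I_D) :
    'M[R]_(N, m) := \matrix_(i, t) (A i t == a)%:R.

Definition Btr (m : nat) (A : 'M['I_D]_(N, m)) : 'M[R]_(N, \sum_(a < D) m) :=
  \mxrow_(a < D) Btr_block A a.

Definition Bpr (ta : assignment N D) : 'M[R]_(N, D) :=
  \matrix_(i, a) (ta i == a)%:R.

Definition colspace_sub (m n p : nat) (A : 'M[R]_(m, n)) (B : 'M[R]_(m, p)) :
    bool :=
  (A^T <= B^T)%MS.

Definition training_treatment_test (rbar m : nat) (Atr : 'M['I_D]_(N, m))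
    (n : 'I_N) (ta : assignment N D) : Prop :=
  colspace_sub (nbhd_rows E n (Bpr ta)) (nbhd_rows E n (Btr Atr)) /\
  forall t : 'I_m,
    (rbar * D <= #|[set s | col s (nbhd_rows E n Atr) ==
                            col t (nbhd_rows E n Atr)]%SET|)%N.

End Test.

(* Main.v *)
(* Units of N(n) are pairwise in conflict, so they have distinct colors, and two
   distinct colors of the same block never get the same label.  Hence, during
   the block of the color of i \in N(n), the unit i is the only one in N(n)
   receiving its (nonbaseline) treatment: the corresponding indicator column is
   the i-th unit vector.  The column space of B^tr[N(n), :] is thus everything,
   which gives (i).  Condition (ii) holds because each column is repeated
   throughout its block. *)
Require Import Defs.
From HB Require Import structures.
From mathcomp Require Import all_boot all_order all_algebra.
From mathcomp Require Import all_classical all_reals all_analysis.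
From mathcomp Require Import zify.

Lemma conflict_sym (N : nat) (E : rel 'I_N) :
  symmetric E -> symmetric (conflict E).
Proof.
move=> E_sym i k; rewrite /conflict eq_sym E_sym; congr (_ && (_ || _)).
by apply/existsP/existsP => -[j /andP[Eij Ejk]]; exists j;
  rewrite E_sym Ejk E_sym Eij.
Qed.

(** The unit [n] itself is the common neighbour of [i] and [k]. *)
Lemma nbhd_conflict (N : nat) (E : rel 'I_N) (n i k : 'I_N) :
  symmetric E -> i \in nbhd E n -> k \in nbhd E n -> i != k -> conflict E i k.
Proof.
move=> E_sym; rewrite !inE => Ein Ekn neq_ik; rewrite /conflict neq_ik /=.
by apply/orP; right; apply/existsP; exists n; rewrite Ein E_sym.
Qed.

Lemma greedy_run_range (V : finType) (adj : rel V) m c :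
  greedy_run adj m c -> forall v k, c v = Some k -> 0 < k <= m.
Proof.
elim=> {m c} [v k|m c v k _ IH _ k_range _ x j|m c v _ IH _ _ x j];
  rewrite ffunE //; case: eqP => _.
- by move=> [<-].
- exact: IH.
- by move=> [<-]; rewrite ltn0Sn leqnn.
- by move=> /IH /andP[-> /leqW].
Qed.

Lemma color_vertex_proper (V : finType) (adj : rel V) c v k :
  irreflexive adj -> symmetric adj -> usable adj c v k ->
  (forall x y j, adj x y -> c x = Some j -> c y <> Some j) ->
  forall x y j, adj x y -> color_vertex c v k x = Some j ->
    color_vertex c v k y <> Some j.
Proof.
move=> adj_irr adj_sym /forallP usable_k proper_c x y j adj_xy; rewrite !ffunE.
case: (eqVneq x v) adj_xy => [->|_]; case: (eqVneq y v) => [->|_] adj_xy.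
- by rewrite adj_irr in adj_xy.
- by move=> [<-]; apply/eqP; move: (usable_k y); rewrite adj_xy.
- move=> cx [kj]; move: (usable_k x).
  by rewrite adj_sym adj_xy cx kj eqxx.
- exact: proper_c.
Qed.

(** Properness is kept along the run: a reused color is usable by assumption, and the new color
    [m.+1] is usable everywhere because all earlier colors are at most [m]. *)
Lemma greedy_run_proper (V : finType) (adj : rel V) m c :
  irreflexive adj -> symmetric adj -> greedy_run adj m c ->
  forall x y j, adj x y -> c x = Some j -> c y <> Some j.
Proof.
move=> adj_irr adj_sym; elim=> {m c} [x y j _|m c v k _ IH _ _ usable_k|
  m c v run_c IH _ _]; first by rewrite ffunE.
  exact: color_vertex_proper.
apply: color_vertex_proper => //; apply/forallP => x; apply/implyP => _.
by apply/eqP => /(greedy_run_range _ _ _ _ run_c); rewrite ltnn andbF.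
Qed.

(** Colors count from 1 but blocks from 0, hence the predecessor in the quotient. *)
Lemma mem_block_colors (D M l k : nat) : 1 < D ->
  (k \in block_colors D M l) = (0 < k <= M) && (k.-1 %/ (D - 1) == l).
Proof.
move=> D_gt1; have p_gt0 : 0 < D - 1 by rewrite subn_gt0.
rewrite /block_colors drop_iota take_iota mem_iota.
case: k => [|k] /=; first by lia.
have := divn_eq k (D - 1); have := ltn_pmod k p_gt0.
set p := D - 1 in p_gt0 *; set q := k %/ p => lt_r def_k.
apply/idP/idP => [k_in|/andP[kM /eqP <-]]; last by lia.
apply/andP; split; first by lia.
by rewrite eqn_leq leq_divRL // -ltnS ltn_divLR //; lia.
Qed.

Lemma block_lt_num_blocks (D M k : nat) : 1 < D -> 0 < k <= M ->
  k.-1 %/ (D - 1) < num_blocks D M.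
Proof.
move=> D_gt1 k_range; rewrite /num_blocks; have p_gt0 : 0 < D - 1 by lia.
(* Here [M] is positive, so the ceiling equals [M.-1 %/ (D - 1) + 1]. *)
have -> : M + (D - 1) - 1 = M.-1 + (D - 1) by lia.
rewrite divnDr // divnn p_gt0 addn1 ltnS; apply: leq_div2r; lia.
Qed.

(** Blocks are given by the quotient of [k.-1], labels by the residue of [k]. Shifting the
    congruence by one makes both concern [k.-1], which quotient and residue determine. *)
Lemma block_mod_inj (p k k' : nat) : 0 < k -> 0 < k' ->
  k.-1 %/ p = k'.-1 %/ p -> k = k' %[mod p] -> k = k'.
Proof.
case: k k' => [|k] [|k'] //= _ _ eq_div /eqP.
rewrite -(addn1 k) -(addn1 k') eqn_modDr => /eqP eq_mod.
by rewrite (divn_eq k p) (divn_eq k' p) eq_div eq_mod.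
Qed.

Lemma block_label_inj (N D M : nat) (coloring : 'I_N -> nat) (l : nat)
    (i k : 'I_N) : 1 < D -> coloring i \in block_colors D M l ->
  block_label D M coloring l k = block_label D M coloring l i ->
  coloring k = coloring i.
Proof.
move=> D_gt1 i_in; rewrite /block_label i_in.
(* Outside the block [k] has the baseline label 1, while the label of [i] is at least 2. *)
case: ifP => [k_in|_]; last by lia.
move=> /eqP; rewrite eqn_add2r => /eqP; move: i_in k_in.
rewrite !mem_block_colors // => /andP[/andP[i_gt0 _] /eqP <-].
move=> /andP[/andP[k_gt0 _] /eqP eq_div]; exact: block_mod_inj.
Qed.

(** [tagnat.Rank a t] is the position, in the concatenated matrix, of column [t] of block [a]. *)
Lemma BtrE (R : realType) (N D m : nat) (A : 'M['I_D]_(N, m)) a t i :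
  Btr R A i (tagnat.Rank a t) = (A i t == a)%:R%R.
Proof.
have := congr1 (fun B : 'M[R]_(N, m) => B i t)
  (mxrowK (fun b : 'I_D => Btr_block R A b) a).
by rewrite !mxE.
Qed.

(** When every unit vector is a column of [B], the rows of the identity lie among those of the
    transpose of [B], which therefore has full row space. *)
Lemma colspace_sub_full (R : realType) (m p q : nat) (A : 'M[R]_(m, p))
    (B : 'M[R]_(m, q)) :
  (forall i, exists j, forall k, B k j = (k == i)%:R%R) -> colspace_sub A B.
Proof.
move=> unit_col; apply: submx_full; rewrite -sub1mx; apply/row_subP => i.
have [j Bj] := unit_col i; suff -> : row i 1%:M%R = row j B^T%R.
  exact: row_sub.
by apply/rowP => k; rewrite !mxE Bj eq_sym.
Qed.

Theorem lemma1 (R : realType) (d : measure_display) (Omega : measurableType d)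
    (P : probability Omega R)
    (N D T r rbar : nat) (hD : (2 <= D)%N) (hrbar : (0 < rbar)%N)
    (E : rel 'I_N) (E_sym : symmetric E) (E_refl : reflexive E)
    (Y : assignment N D -> 'I_T -> 'I_N -> {RV P >-> R})
    (hY : latent_factor_model r E Y)
    (Ttr : {set 'I_T}) (Atr : 'M['I_D]_(N, #|Ttr|))
    (hAtr : coloring_design E rbar Atr)
    (n : 'I_N) (ta : assignment N D) :
  training_treatment_test R E rbar Atr n ta.
Proof.
case: hAtr => M [coloring [Tbar [part [greedy]]]].
case=> cover_part _ card_part le_Tbar label_A.
have color_range i : 0 < coloring i <= M.
  by apply: (greedy_run_range _ _ _ _ greedy i); rewrite ffunE.
have nbhd_color_inj i k : i \in nbhd E n -> k \in nbhd E n ->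
    coloring k = coloring i -> k = i.
  move=> i_nbhd k_nbhd eq_color; apply/eqP; apply: contraT => neq_ki.
  have conf_irr : irreflexive (conflict E) by move=> x; rewrite /conflict eqxx.
  have conf_ki := nbhd_conflict _ _ _ _ _ E_sym k_nbhd i_nbhd neq_ki.
  have := greedy_run_proper _ _ _ _ conf_irr (conflict_sym _ _ E_sym) greedy
    _ _ (coloring k) conf_ki.
  by rewrite !ffunE eq_color => /(_ erefl).
have part_sub l t : t \in part l -> t \in Ttr.
  by move=> t_in; rewrite -cover_part; apply/bigcupP; exists l.
split.
  apply: colspace_sub_full => i; set v := enum_val i.
  pose l := Ordinal (block_lt_num_blocks _ _ _ hD (color_range v)).
  have v_in : coloring v \in block_colors D M l.
    by rewrite mem_block_colors // color_range eqxx.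
  (* The block is nonempty: its size [Tbar] is at least [rbar * D], which is positive. *)
  have [t t_in] : exists t, t \in part l.
    by apply/card_gt0P; rewrite card_part; nia.
  pose s := enum_rank_in (part_sub _ _ t_in) t.
  have s_in : enum_val s \in part l by rewrite enum_rankK_in ?(part_sub l).
  (* The unit vector is column [s] of the indicator block of the treatment that [v] receives at
     [s]. *)
  exists (tagnat.Rank (Atr v s) s) => k; rewrite mxE BtrE.
  congr (nat_of_bool _)%:R%R.
  apply/eqP/eqP => [eq_A|-> //]; apply: enum_val_inj.
  apply: nbhd_color_inj; try exact: enum_valP.
  apply: (block_label_inj _ _ _ _ _ _ _ hD v_in).
  by rewrite -!(label_A l s) // eq_A.
move=> t; have [l _ t_in] : exists2 l, true & enum_val t \in part l.
  by apply/bigcupP; rewrite cover_part enum_valP.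
apply: leq_trans le_Tbar _; rewrite -(card_part l).
(* [part l] consists of measurements, whereas the test counts columns of [Atr]; [S] is the same set
   in column indices, of equal size since [enum_val] is injective. *)
pose S := [set s : 'I_#|Ttr| | enum_val s \in part l]%SET.
have -> : part l = [set enum_val s | s in S]%SET.
  apply/setP => x; apply/idP/imsetP => [x_in|[s]]; last by rewrite inE => s_in ->.
  exists (enum_rank_in (part_sub _ _ x_in) x); last first.
    by rewrite enum_rankK_in ?(part_sub l).
  by rewrite inE enum_rankK_in ?(part_sub l).
rewrite card_imset; last exact: enum_val_inj.
apply/subset_leq_card/fintype.subsetP => s; rewrite !inE => s_in.
(* Passing to successors turns entries into labels, which depend only on the block and the unit. *)
apply/eqP/colP => k; rewrite !mxE; apply/val_inj/succn_inj.
by rewrite /= !(label_A l).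
Qed.
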